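(* Let $X,Y,Z$ be locally convex Hausdorff topological vector spaces and let $K\subset Y$ be a proper closed convex cone with $\operatorname{int}K\neq\emptyset$. Let $\Phi\colon X\times Z\to Y\cup\{+\infty_Y\}$ be a $K$-convex and $K$-epi closed mapping, let $x_0\in X$ be such that $(x_0,0_Z)\in\operatorname{dom}\Phi$, let $\pi\colon X\times Z\to Z$ be the projection $\pi(x,z)=z$, and let $Z_0=\operatorname{lin}(\pi(\operatorname{dom}\Phi))$. Let $U_0$ be a neighborhood of $x_0$ in $X$ and $V_0$ a neighborhood of $\Phi(x_0,0_Z)$ in $Y$. Assume that $X$ and $Y$ are first countable and complete, that $Z_0$ is a barreled space, and that $0_Z\in\operatorname{icr}(\pi(\operatorname{dom}\Phi))$. Then $$0_Z\in \operatorname{int}_{Z_0}\{z\in Z:\ \Phi(x,z)\leqq_K y \text{ for some } x\in U_0 \text{ and } y\in V_0\}.$$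
   Context: $K$ proper means $K\ne Y$. $y_1\leqq_K y_2$ means $y_1-y_2\in -K$ (so $+\infty_Y\not\leqq_K y$ for $y\in Y$). $\operatorname{dom}\Phi=\{(x,z):\Phi(x,z)\neq+\infty_Y\}$. The $K$-epigraph of $\Phi$ is $\{(x,z,y)\in X\times Z\times Y: y\in\Phi(x,z)+K\}$; $\Phi$ is $K$-convex (resp. $K$-epi closed) if its $K$-epigraph is convex (resp. closed in $X\times Z\times Y$). $\operatorname{lin}$ is the linear hull, $\operatorname{aff}$ the affine hull; $Z_0$ carries the topology induced by $Z$, and $\operatorname{int}_{Z_0}$ is the interior with respect to that topology. The intrinsic core of $U\subset Z$ is $\operatorname{icr}U=\{z\in Z:\forall z'\in\operatorname{aff}U\ \exists\delta>0 \text{ such that } z+\lambda z'\in U\ \forall\lambda\in[0,\delta]\}$. Complete means that every Cauchy net converges. A locally convex Hausdorff space is barreled if every absorbing, convex, closed subset is a neighborhood of the origin. *)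

(* Defs.v *)
From HB Require Import structures.
From mathcomp Require Import all_boot all_order all_algebra.
From mathcomp Require Import all_classical all_reals all_analysis.

Set Implicit Arguments.
Unset Strict Implicit.
Unset Printing Implicit Defensive.

Import Order.TTheory GRing.Theory Num.Theory.

Local Open Scope classical_set_scope.
Local Open Scope ring_scope.

Section LinearHulls.
Context {R : realType} {E : lmodType R}.
Implicit Types A C L U : set E.

Definition convex_cone C : Prop :=
  convex_set C /\ forall (t : R) (x : E), 0 <= t -> C x -> C (t *: x).

Definition linear_subspace L : Prop :=
  [/\ L 0, (forall x y, L x -> L y -> L (x + y))
    & (forall (t : R) x, L x -> L (t *: x))].

Definition affine_subspace L : Prop :=
  forall (t : R) x y, L x -> L y -> L (t *: x + (1 - t) *: y).

Definition lin A : set E := smallest linear_subspace A.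

Definition aff A : set E := smallest affine_subspace A.

Definition icr U : set E :=
  [set z | forall z', aff U z' -> exists2 delta : R, 0 < delta &
    forall lambda : R, 0 <= lambda <= delta -> U (z + lambda *: z')].

Definition absorbing_in L C : Prop :=
  forall z, L z -> exists2 delta : R, 0 < delta &
    forall lambda : R, 0 <= lambda <= delta -> C (lambda *: z).

End LinearHulls.

(* Barreledness of the linear subspace L of E endowed with the induced
   topology. Local convexity and the Hausdorff property are inherited from E. *)
Definition barreled_subspace {R : realType} {E : tvsType R} (L : set E) : Prop :=
  forall C : set E, C `<=` L -> absorbing_in L C -> convex_set C ->
    closed (C : set (subspace L)) -> nbhs (0 : subspace L) C.

Definition first_countable (T : topologicalType) : Prop :=
  forall x : T, exists2 B : set (set T), countable B &
    B `<=` nbhs x /\ forall U, nbhs x U -> exists2 V, B V & V `<=` U.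

Definition directed (I : Type) (le : I -> I -> Prop) : Prop :=
  [/\ inhabited I, (forall i, le i i),
      (forall i j k, le i j -> le j k -> le i k)
    & (forall i j, exists2 k, le i k & le j k)].

Definition net_tails (I : Type) (le : I -> I -> Prop) : set_system I :=
  filter_from [set: I] (fun i => [set j | le i j]).

Definition cauchy_net (E : topologicalZmodType) (I : Type)
    (le : I -> I -> Prop) (u : I -> E) : Prop :=
  forall U : set E, nbhs 0 U ->
    exists i0, forall i j, le i0 i -> le i0 j -> U (u i - u j).

(* The library's [cauchy] is not used: it refers to the entourages of a
   [tvsType], which are only required to induce its topology and need not be
   those of the additive group. *)
Definition complete_space (E : topologicalZmodType) : Prop :=
  forall (I : Type) (le : I -> I -> Prop) (u : I -> E),
    directed le -> cauchy_net le u -> exists l : E, u @ net_tails le --> l.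

(* [option Y] stands for the set Y with the element +oo_Y adjoined, [None]
   being +oo_Y. *)
Section ExtendedMaps.
Context {R : realType} {Y : tvsType R}.
Implicit Type K : set Y.

Definition add_infty (a : option Y) (k : Y) : option Y :=
  omap (fun y => y + k) a.

Definition leK K (a : option Y) (y : Y) : Prop :=
  if a is Some y1 then (-%R @` K) (y1 - y) else False.

Definition dom (T : Type) (Phi : T -> option Y) : set T :=
  [set p | Phi p <> None].

Definition epigraph (T : Type) K (Phi : T -> option Y) : set (T * Y) :=
  [set p | exists2 k, K k & Some p.2 = add_infty (Phi p.1) k].

Context {X Z : tvsType R}.

Definition K_convex K (Phi : X * Z -> option Y) : Prop :=
  convex_set (epigraph K Phi : set (X * Z * Y)).

Definition K_epi_closed K (Phi : X * Z -> option Y) : Prop :=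
  closed (epigraph K Phi : set (X * Z * Y)).

End ExtendedMaps.

(* Main.v *)
(* This is the Ursescu-Robinson open mapping argument for the convex relation
   C between X * Y and Z given by the K-epigraph of Phi, translated so that
   ((0, 0), 0) is in C. Take a decreasing base U n of convex neighbourhoods of 0
   in X * Y, and let W n be the image of U n under C. It is convex and absorbing
   in Z0, so its closure is a neighbourhood of 0 in Z0 by barreledness. To solve
   C u z when 2 z is in the closure of W 0, pick successively w_n in W n, the
   image of some u_n in U n, such that twice the residual, b_(n+1) =
   2 (b_n - w_n), lies in the closure of W (n+1), starting from b_0 = 2 z.
   The partial sums of 2^-(n+1) (u_n, w_n) stay in C by convexity, their first
   components are Cauchy, and closedness of C makes the limit a solution. *)

Require Import Defs.
From HB Require Import structures.
From mathcomp Require Import all_boot all_order all_algebra.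
From mathcomp Require Import all_classical all_reals all_analysis.
From mathcomp Require Import ring lra.

Set Implicit Arguments.
Unset Strict Implicit.

Import Order.TTheory GRing.Theory Num.Theory.

Local Open Scope classical_set_scope.
Local Open Scope ring_scope.

(** * Convexity, linear combinations, neighbourhood bases and completeness *)

Lemma convex_setP (R : realType) (E : lmodType R) (A : set E) :
  convex_set (A : set (convex_lmodType E)) <->
  (forall (t : R) x y, 0 <= t <= 1 -> A x -> A y -> A (t *: x + (1 - t) *: y)).
Proof.
split=> [cA t x y t01 Ax Ay|cA x y t /set_mem Ax /set_mem Ay].
  have [t0 t1] := andP t01.
  have [->|tn0] := eqVneq t 0; first by rewrite scale0r add0r subr0 scale1r.
  have := cA x y (Itv01 t0 t1) (mem_set Ax) (mem_set Ay).
  by move=> /set_mem.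
apply/mem_set; apply: cA => //.
by rewrite ge0 le1.
Qed.

Lemma linear_combination_continuous (R : realType) (E : tvsType R) (s t : R) :
  continuous (fun p : E * E => s *: p.1 + t *: p.2).
Proof.
have scaled (r : R) (f : E * E -> E) : continuous f ->
    continuous (fun p => r *: f p).
  move=> cf p.
  apply: (@continuous_comp _ (R^o * E)%type _ (fun p => (r, f p))
    (fun q => q.1 *: q.2)); last exact: scale_continuous.
  by apply: (@cvg_pair _ _ _ _ (nbhs (r : R^o))); [exact: cvg_cst|exact: cf].
move=> p; apply: (@continuous_comp _ (E * E)%type _
  (fun p => (s *: p.1, t *: p.2)) (fun q => q.1 + q.2)).
  by apply: cvg_pair; apply: scaled => ?; [exact: cvg_fst|exact: cvg_snd].
exact: add_continuous.
Qed.

Lemma affine_continuous (R : realType) (E : tvsType R) (a : E) (t : R) :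
  continuous (fun x => a + t *: x).
Proof.
move=> x.
have := @continuous_comp E (E * E)%type E (fun x => (a, x))
  (fun p => 1 *: p.1 + t *: p.2) x.
rewrite /comp /= scale1r; apply; last exact: linear_combination_continuous.
by apply: cvg_pair; [exact: cvg_cst|exact: cvg_id].
Qed.

Lemma convex_closure (R : realType) (E : tvsType R) (A : set E) :
  convex_set (A : set (convex_lmodType E)) ->
  convex_set (closure A : set (convex_lmodType E)).
Proof.
move=> /convex_setP cA; apply/convex_setP => t x y t01 clx cly B.
move=> /(@linear_combination_continuous _ _ t (1 - t) (x, y))[[P Q] /= [nP nQ] PQB].
have [x' [Ax' Px']] := clx _ nP; have [y' [Ay' Qy']] := cly _ nQ.
by exists (t *: x' + (1 - t) *: y'); split; [exact: cA|exact: (PQB (x', y'))].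
Qed.

Lemma convex_set_star (R : realType) (E : lmodType R) (A : set E) (t : R) x :
  convex_set (A : set (convex_lmodType E)) -> A 0 -> 0 <= t <= 1 ->
  A x -> A (t *: x).
Proof.
move=> /convex_setP cA A0 t01 Ax.
by have := cA _ _ _ t01 Ax A0; rewrite scaler0 addr0.
Qed.

Lemma nbhs_convex (R : realType) (E : tvsType R) (x : E) (V : set E) :
  nbhs x V -> exists U : set E,
    [/\ convex_set (U : set (convex_lmodType E)), nbhs x U & U `<=` V].
Proof.
move=> nV; have [B cB [oB bB]] := @locally_convex R E.
have [U [BU Ux] UV] := bB x V nV.
exists U; split => //; first exact/cB/mem_set.
by apply: open_nbhs_nbhs; split => //; exact: oB.
Qed.

(** Enumerate a countable base [e] at 0 and choose [U n.+1] convex inside both [U n] and [e n]: the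
    former makes the sequence decreasing, the latter makes it a base. *)
Lemma convex_nbhs0_basis (R : realType) (E : tvsType R) (V : set E) :
  first_countable E -> nbhs 0 V ->
  exists U : nat -> set E,
    [/\ forall n, convex_set (U n : set (convex_lmodType E)),
        forall n, nbhs 0 (U n), forall m n, (m <= n)%N -> U n `<=` U m,
        forall P, nbhs 0 P -> exists n, U n `<=` P & U 0%N `<=` V].
Proof.
move=> fcE nV; have [B cB [Bnbhs basisB]] := fcE 0.
(* When [W] is not a neighbourhood of 0 the property is vacuous and any set will do. *)
have /choice[c cP] (W : set E) : exists U : set E, nbhs 0 W ->
    [/\ convex_set (U : set (convex_lmodType E)), nbhs 0 U & U `<=` W].
  have [nW|nW] := pselect (nbhs 0 W); last by exists set0.
  by have [U UP] := nbhs_convex nW; exists U.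
have [e eB eS] : exists2 e : nat -> set E, (forall n, nbhs 0 (e n)) &
    forall P, nbhs 0 P -> exists n, e n `<=` P.
  move/pfcard_geP : cB => [B0|[e]].
    by have [W] := basisB _ (filterT : nbhs (0 : E) setT); rewrite B0.
  exists e => [n|P /basisB[W BW WP]]; first exact/Bnbhs/funS.
  have [n _ enW] := @surj _ _ _ _ e _ BW; exists n.
  by rewrite enW.
pose U := fix U n := if n is m.+1 then c (U m `&` e m) else c V.
have nU n : nbhs 0 (U n).
  elim: n => [|n IHn] /=; first by have [] := cP _ nV.
  by have [] := cP _ (filterI IHn (eB n)).
have US n : U n.+1 `<=` U n `&` e n.
  by have [] := cP _ (filterI (nU n) (eB n)).
exists U; split => //.
- by case=> [|n]; [have [] := cP _ nV|have [] := cP _ (filterI (nU n) (eB n))].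
- move=> m n /subnK <-; elim: (n - m)%N => [//|k IHk] x.
  by rewrite addSn => /US[/IHk].
- move=> P /eS[n enP]; exists n.+1; apply: subset_trans enP.
  by apply: subset_trans (US n) _; exact: subIsetr.
- by have [] := cP _ nV.
Qed.

(** Ordered by [<=], [nat] is directed, so a sequence is a net; this is the form needed for the
    partial sums. *)
Lemma complete_space_seq (E : topologicalZmodType) (u : nat -> E) :
  complete_space E ->
  (forall U : set E, nbhs 0 U ->
    exists n, forall i j, (n <= i)%N -> (n <= j)%N -> U (u i - u j)) ->
  exists l : E, forall P, nbhs l P ->
    exists n, forall m, (n <= m)%N -> P (u m).
Proof.
move=> cE cu.
have le_directed : directed (fun i j : nat => (i <= j)%N).
  split=> [||i j k ij jk|i j] /=; [exact: (inhabits 0%N)|by []|exact: leq_trans jk|].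
  by exists (maxn i j); rewrite ?leq_maxl ?leq_maxr.
have [l ul] := cE _ _ u le_directed cu.
by exists l => P /ul[n _ nP]; exists n => m /nP.
Qed.

(** * Images of neighbourhoods under a closed convex relation *)

Definition graph_image {E Z : Type} (C : set (E * Z)) (U : set E) : set Z :=
  [set z | exists2 u, U u & C (u, z)].

Lemma graph_image_convex (R : realType) (E Z : lmodType R) (C : set (E * Z))
    (U : set E) :
  convex_set (C : set (convex_lmodType (E * Z)%type)) ->
  convex_set (U : set (convex_lmodType E)) ->
  convex_set (graph_image C U : set (convex_lmodType Z)).
Proof.
move=> /convex_setP cC /convex_setP cU; apply/convex_setP.
move=> t x y t01 [u Uu Cux] [v Uv Cvy].
exists (t *: u + (1 - t) *: v); first exact: cU.
by have := cC _ _ _ t01 Cux Cvy.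
Qed.

Lemma halving_itv (R : realType) n : 0 <= (2^-1 : R) ^+ n <= 1.
Proof. by apply/andP; split; [apply: exprn_ge0; lra|apply: exprn_ile1; lra]. Qed.

Lemma convex_half (R : realType) (E : lmodType R) (A : set E) x y :
  convex_set (A : set (convex_lmodType E)) -> A x -> A y ->
  A (2^-1 *: x + 2^-1 *: y).
Proof.
move=> /convex_setP cA Ax Ay; have := cA _ _ _ (halving_itv R 1) Ax Ay.
by rewrite expr1 [X in 1 - X]splitr; congr (A (_ + _ *: _)); lra.
Qed.

Lemma nbhs_subspace_withinP (T : topologicalType) (L : set T) (x : T)
    (A : set T) :
  L x -> (nbhs (x : subspace L) A <-> nbhs x [set y | L y -> A y]).
Proof. by move=> Lx; case: (nbhs_subspaceP L x). Qed.

(** The closure moves from the image to the source at the price of a factor 2: the first correction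
    enters with weight 1/2, so it has to approximate [2 *: z]. *)
Lemma graph_image_closure_sub (R : realType) (E Z : tvsType R)
    (C : set (E * Z)) (L : set Z) (U : nat -> set E) :
  complete_space E -> closed C ->
  convex_set (C : set (convex_lmodType (E * Z)%type)) -> C (0, 0) ->
  linear_subspace L -> (forall p, C p -> L p.2) ->
  (forall n, convex_set (U n : set (convex_lmodType E))) ->
  (forall n, nbhs 0 (U n)) -> (forall m n, (m <= n)%N -> U n `<=` U m) ->
  (forall P, nbhs 0 P -> exists n, U n `<=` P) ->
  (forall n, nbhs (0 : subspace L) (closure (graph_image C (U n)))) ->
  forall z, L z -> closure (graph_image C (U 0%N)) (2 *: z) ->
  graph_image C (closure (U 0%N)) z.
Proof.
move=> cE clC cC C0 [L0 LD LZ] CL cU nU Umono Ubase nW z Lz Wz.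
have U0 n : U n 0 := nbhs_singleton (nU n).
pose W n := graph_image C (U n).
have step n (b : Z) : L b -> closure (W n) b -> exists2 q : E * Z,
    U n q.1 /\ C q & closure (W n.+1) (2 *: (b - q.2)).
  move=> Lb clb.
  have /(nbhs_subspace_withinP _ L0) nW1 := nW n.+1.
  (* The map [w |-> 2 *: (b - w)] sends [b] to 0, so every [w] in [L] close to [b] is admissible;
     [b] being in the closure of [W n], some such [w] lies in [W n]. *)
  have : nbhs b [set w | L (2 *: (b - w)) -> closure (W n.+1) (2 *: (b - w))].
    have := @affine_continuous _ Z (2 *: b) (- 2) b.
    rewrite /continuous_at scaleNr subrr => /(_ _ nW1).
    apply: (@filterS _ (nbhs b)) => w /=.
    by rewrite scaleNr -scalerBr; exact.
  move=> /clb[w [[u Uu Cuw] /= cl]]; exists (u, w) => //.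
  apply: cl; apply: (LZ); apply: LD => //; rewrite -scaleN1r; apply: LZ.
  exact: CL Cuw.
have /choice[f fP] (nb : nat * Z) : exists q : E * Z,
    L nb.2 -> closure (W nb.1) nb.2 ->
    [/\ U nb.1 q.1, C q & closure (W nb.1.+1) (2 *: (nb.2 - q.2))].
  have [[Lb clb]|nLb] := pselect (L nb.2 /\ closure (W nb.1) nb.2).
    by have [q [Uq Cq] clq] := step _ _ Lb clb; exists q.
  by exists 0 => Lb clb; exfalso; apply: nLb.
(* Here [b n = 2 ^ n.+1 *: (z - (c n).2)] is the rescaled residual. *)
pose b := fix b n := if n is m.+1 then 2 *: (b m - (f (m, b m)).2) else 2 *: z.
pose q n := f (n, b n).
(* The term [q m] has weight 2^-(m+1), so the weights in [c n] add up to 1 - 2^-n and leave 2^-n for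
   one further point. *)
pose c := fix c n := if n is m.+1 then c m + 2^-1 ^+ n *: q m else 0.
have bS n : b n.+1 = 2 *: (b n - (q n).2) by [].
have cS n : c n.+1 = c n + 2^-1 ^+ n.+1 *: q n by [].
have bP n : L (b n) /\ closure (W n) (b n).
  elim: n => [|n [Lb clb]]; first by split => //; exact: LZ.
  have [_ Cq clq] := fP (n, b n) Lb clb.
  split => //; apply: (LZ); apply: LD => //; rewrite -scaleN1r; apply: LZ.
  exact: CL.
have qU n : U n (q n).1 by have [Lb clb] := bP n; have [] := fP (n, b n) Lb clb.
have qC n : C (q n) by have [Lb clb] := bP n; have [] := fP (n, b n) Lb clb.
have zE n : z = (c n).2 + 2^-1 ^+ n.+1 *: b n.
  elim: n => [|n IHn]; first by rewrite expr1 /= add0r scalerA mulVf// scale1r.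
  rewrite {1}IHn cS bS /= -addrA; congr (_ + _).
  rewrite [2^-1 ^+ n.+2]exprSr scalerA divfK// -scalerDr.
  by rewrite addrC subrK.
(* Adding [p] at stage [n.+1] amounts to adding the midpoint of [q n] and [p] at stage [n].
   Membership in a convex set thus descends to stage 0. *)
have cE2 n (p : E * Z) : c n.+1 + 2^-1 ^+ n.+1 *: p =
    c n + 2^-1 ^+ n *: (2^-1 *: q n + 2^-1 *: p).
  by rewrite cS scalerDr !scalerA -exprSr addrA.
have cC_stable n p : C p -> C (c n + 2^-1 ^+ n *: p).
  elim: n p => [|n IHn] p Cp; first by rewrite expr0 scale1r /= add0r.
  by rewrite cE2; apply: IHn; exact: convex_half.
pose s n := (c n).1.
(* The same midpoint descent, stopped at stage [m]: the weights add up to 2^-m, at most 1, and all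
   points used lie in [U m]. *)
have sU m n u : (m <= n)%N -> U n u -> U m (s n - s m + 2^-1 ^+ n *: u).
  move=> /subnKC <-; elim: (n - m)%N u => [|k IHk] u.
    by rewrite addn0 subrr add0r; exact: convex_set_star (halving_itv R m).
  rewrite addnS => Uu.
  have -> : s (m + k).+1 - s m + 2^-1 ^+ (m + k).+1 *: u =
      s (m + k)%N - s m + 2^-1 ^+ (m + k) *:
        (2^-1 *: (q (m + k)%N).1 + 2^-1 *: u).
    by rewrite scalerDr !scalerA -exprSr /s cS /= addrA [_ + _ - _]addrAC.
  apply: IHk; apply: convex_half => //.
  exact: Umono Uu.
have sU0 m n : (m <= n)%N -> U m (s n - s m).
  by move=> /sU/(_ (U0 n)); rewrite scaler0 addr0.
have [|l sl] := @complete_space_seq E s cE.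
  move=> V nV.
  have := @linear_combination_continuous _ E 1 (- 1) (0, 0).
  rewrite /continuous_at /= !scaler0 addr0 => /(_ _ nV)[[P Q] /= [nP nQ] PQ].
  have [n nPQ] := Ubase _ (filterI nP nQ); exists n => i j ni nj.
  have [Pi _] := nPQ _ (sU0 _ _ ni); have [_ Qj] := nPQ _ (sU0 _ _ nj).
  have := PQ (_, _) (conj Pi Qj); rewrite /= scale1r scaleN1r.
  by rewrite opprB addrA subrK.
(* Since [s 0] is 0, [sU0] puts all partial sums in [U 0], hence their limit in its closure. *)
exists l.
  move=> P /sl[n nP]; exists (s n); split; last exact: nP.
  by have := sU0 0%N n (leq0n n); rewrite /s /= subr0.
(* [b n] is only known to lie in the closure of [W n], and it need not be
   bounded in n: so [z] is not obtained as the limit of [(c n).2]. Instead, one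
   more correction [w] close to [b n] brings the point within any prescribed
   neighbourhood of [(l, z)] while staying in [C]. *)
apply: clC => B [[P Q] /= [nP nQ] PQB].
have := @linear_combination_continuous _ E 1 1 (l, 0).
rewrite /continuous_at /= !scale1r addr0 => /(_ _ nP)[[P1 P2] /= [nP1 nP2] PP].
have [n1 n1P] := sl _ nP1; have [n2 n2P] := Ubase _ nP2.
pose n := maxn n1 n2.
have nQ' : nbhs (b n) [set w | Q ((c n).2 + 2^-1 ^+ n.+1 *: w)].
  by apply: affine_continuous; rewrite -zE.
have [w [[u Uu Cuw] Qw]] := (bP n).2 _ nQ'.
exists (c n + 2^-1 ^+ n.+1 *: (u, w)); split.
  (* The weight 2^-(n+1), imposed by [zE], is half of what [cC_stable] allows; the other half goes
     to the origin of [C]. *)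
  rewrite exprSr -scalerA; apply: cC_stable.
  by apply: convex_set_star => //; have := halving_itv R 1; rewrite expr1.
apply: PQB; split => //=.
have /= := PP (s n, 2^-1 ^+ n.+1 *: u); rewrite !scale1r; apply; split => /=.
  by apply: n1P; rewrite leq_maxl.
apply/n2P/(Umono n2 n); first by rewrite leq_maxr.
exact: convex_set_star (halving_itv R n.+1) _.
Qed.

(** Shrinking a pair [(u, d *: z)] of [C] towards the origin keeps it in [C] and eventually brings
    its first component into [U]. *)
Lemma absorbing_graph_image (R : realType) (E Z : tvsType R)
    (C : set (E * Z)) (L : set Z) (U : set E) :
  convex_set (C : set (convex_lmodType (E * Z)%type)) -> C (0, 0) ->
  convex_set (U : set (convex_lmodType E)) -> nbhs 0 U ->
  absorbing_in L (graph_image C setT) -> absorbing_in L (graph_image C U).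
Proof.
move=> cC C0 cU nU aC z /aC[d d0 /(_ d)].
rewrite lexx (ltW d0) => /(_ isT)[u _ Cu].
have : nbhs (0 : R^o) [set t | U (t *: u)].
  have := @scale_continuous _ E (0, u).
  rewrite /continuous_at /= scale0r => /(_ _ nU)[[P Q] /= [nP nQ] PQ].
  apply: filterS nP => t Pt; apply: (PQ (t, u)); split => //.
  exact: nbhs_singleton nQ.
move=> /nbhs_ballP[e /= e0 eU].
(* The bound [e / 2] gives [U (t *: u)]; the bound 1 gives [r / d <= 1], so that scaling the pair is
   a convex combination with the origin. *)
pose t := Num.min 1 (e / 2).
have t0 : 0 < t by rewrite lt_min ltr01 divr_gt0.
have Ut : U (t *: u).
  apply: eU; rewrite -ball_normE /= sub0r normrN gtr0_norm//.
  rewrite gt_min; apply/orP; right; lra.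
exists (t * d); first exact: mulr_gt0.
move=> r /andP[r0 rtd].
have dneq0 : d != 0 by rewrite gt_eqF.
have tneq0 : t != 0 by rewrite gt_eqF.
have U0 : U 0 := nbhs_singleton nU.
exists ((r / d) *: u).
  have -> : (r / d) *: u = (r / (t * d)) *: (t *: u).
    by rewrite scalerA; congr (_ *: _); field; rewrite tneq0 dneq0.
  apply: convex_set_star => //.
  apply/andP; split; first by rewrite divr_ge0// ltW// mulr_gt0.
  by rewrite ler_pdivrMr ?mulr_gt0// mul1r.
have -> : ((r / d) *: u, r *: z) = (r / d) *: (u, d *: z).
  by congr (_, _); rewrite /= scalerA divfK.
apply: convex_set_star => //.
apply/andP; split; first by rewrite divr_ge0// ltW.
by rewrite ler_pdivrMr// mul1r (le_trans rtd)// ger_pMl// ge_min lexx.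
Qed.

Lemma nbhs_graph_image (R : realType) (E Z : tvsType R)
    (C : set (E * Z)) (L : set Z) (U : set E) :
  first_countable E -> complete_space E -> closed C ->
  convex_set (C : set (convex_lmodType (E * Z)%type)) -> C (0, 0) ->
  linear_subspace L -> barreled_subspace L -> (forall p, C p -> L p.2) ->
  absorbing_in L (graph_image C setT) -> nbhs 0 U ->
  nbhs (0 : subspace L) (graph_image C U).
Proof.
move=> fcE cE clC cC C0 linL barL CL aC nU.
have [L0 LD LZ] := linL.
(* The iteration only yields solutions in the closure of [B 0], so [V] is taken with its closure
   inside [U]. *)
have [V nV VU] := uniform_regular nU.
have [B [cB nB Bmono Bbase BV]] := convex_nbhs0_basis fcE nV.
have nW n : nbhs (0 : subspace L) (closure (graph_image C (B n))).
  (* The closure is taken in [Z], whereas a barrel must lie in [L]: hence the intersection. *)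
  have : nbhs (0 : subspace L) (closure (graph_image C (B n)) `&` L).
    apply: barL.
    - exact: subIsetr.
    - move=> z Lz.
      have [d d0 dB] := absorbing_graph_image cC C0 (cB n) (nB n) aC Lz.
      exists d => // r rd; split; last exact: LZ.
      exact/subset_closure/dB.
    - apply/convex_setP => t x y t01 [clx Lx] [cly Ly]; split.
        have /convex_closure/convex_setP := graph_image_convex cC (cB n).
        exact.
      by apply: LD; exact: LZ.
    - apply/closed_subspaceP; exists (closure (graph_image C (B n))).
        exact: closed_closure.
      by rewrite -setIA setIid.
  by apply: filterS; exact: subIsetl.
have /(nbhs_subspace_withinP _ L0) nW0 := nW 0%N.
apply/(nbhs_subspace_withinP _ L0).
have : nbhs 0 [set z | L (2 *: z) -> closure (graph_image C (B 0%N)) (2 *: z)].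
  have := @affine_continuous _ Z 0 2 0.
  rewrite /continuous_at scaler0 addr0 => /(_ _ nW0).
  by apply: (@filterS _ (nbhs 0)) => w /=; rewrite add0r.
apply: filterS => z /= zW Lz.
have [u clu Cuz] := graph_image_closure_sub cE clC cC C0 linL CL cB nB
  Bmono Bbase nW Lz (zW (LZ _ _ Lz)).
by exists u => //; apply: VU; exact: closureS clu.
Qed.

(** * Products of complete and of first countable spaces *)

Lemma complete_space_prod (R : realType) (E F : tvsType R) :
  complete_space E -> complete_space F -> complete_space (E * F)%type.
Proof.
move=> cE cF I le u dir cu.
have [|l1 ul1] := cE _ _ (fun i => (u i).1) dir.
  move=> V nV.
  have [|i0 i0P] := cu (fst @^-1` V); first exact: cvg_fst.
  by exists i0.
have [|l2 ul2] := cF _ _ (fun i => (u i).2) dir.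
  move=> V nV.
  have [|i0 i0P] := cu (snd @^-1` V); first exact: cvg_snd.
  by exists i0.
exists (l1, l2) => P [[P1 P2] /= [nP1 nP2] P12].
have [_ _ le_trans le_dir] := dir.
have [[i _ iP] [j _ jP]] := (ul1 _ nP1, ul2 _ nP2).
have [k ik jk] := le_dir i j; exists k => // m /= km.
by apply: P12; split; [apply: iP; exact: le_trans km|apply: jP; exact: le_trans km].
Qed.

Lemma first_countable_prod (S T : topologicalType) :
  first_countable S -> first_countable T -> first_countable (S * T)%type.
Proof.
move=> fS fT [x y]; have [B cB [Bx xB]] := fS x; have [D cD [Dy yD]] := fT y.
exists ((fun p => p.1 `*` p.2) @` (B `*` D)).
  exact: sub_countable (card_image_le _ _) (countableX cB cD).
split=> [_ [[P Q] /= [/Bx nP /Dy nQ] <-]|U [[P Q] /= [nP nQ] PQU]].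
  by exists (P, Q).
have [P' BP' P'P] := xB _ nP; have [Q' DQ' Q'Q] := yD _ nQ.
exists (P' `*` Q'); first by exists (P', Q').
by apply: subset_trans PQU; exact: setSX.
Qed.

(** * Linear and affine hulls *)

Lemma linear_subspace_lin (R : realType) (E : lmodType R) (A : set E) :
  linear_subspace (lin A).
Proof.
split=> [M [[]]//|x y Ax Ay M MP|t x Ax M MP].
  by have [[_ MD _] _] := MP; apply: MD; [exact: Ax|exact: Ay].
by have [[_ _ MZ] _] := MP; apply: MZ; exact: Ax.
Qed.

(** Affine combinations with 0 give multiples, and the midpoint of [2 *: x] and [2 *: y] gives the
    sum. *)
Lemma linear_subspace_aff (R : realType) (E : lmodType R) (A : set E) :
  A 0 -> linear_subspace (aff A).
Proof.
move=> A0.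
have aff0 : aff A 0 by exact: sub_gen_smallest.
have affP : affine_subspace (aff A).
  move=> t x y Ax Ay M MP; have [Maff _] := MP.
  by apply: Maff; [exact: Ax|exact: Ay].
have affZ t x : aff A x -> aff A (t *: x).
  by move=> Ax; have := affP t _ _ Ax aff0; rewrite scaler0 addr0.
split=> // x y Ax Ay.
have := affP 2^-1 _ _ (affZ 2 _ Ax) (affZ 2 _ Ay).
rewrite !scalerA mulVf// (_ : (1 - 2^-1) * 2 = 1) ?scale1r//.
by field.
Qed.

(** Links [icr], which tests directions in the affine hull, to [Z0], a linear hull. *)
Lemma lin_sub_aff (R : realType) (E : lmodType R) (A : set E) :
  A 0 -> lin A `<=` aff A.
Proof.
move=> A0; apply: smallest_sub; first exact: linear_subspace_aff.
exact: sub_gen_smallest.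
Qed.

Unset Implicit Arguments.

Theorem theorem2p1 (R : realType) (X Y Z : tvsType R)
    (X_hausdorff : hausdorff_space X) (Y_hausdorff : hausdorff_space Y)
    (Z_hausdorff : hausdorff_space Z)
    (K : set Y) (K_proper : K <> [set: Y]) (K_closed : closed K)
    (K_cone : convex_cone K) (K_int : K° !=set0)
    (Phi : X * Z -> option Y)
    (Phi_convex : K_convex K Phi) (Phi_closed : K_epi_closed K Phi)
    (x0 : X) (x0_dom : dom Phi (x0, 0))
    (U0 : set X) (U0_nbhs : nbhs x0 U0)
    (V0 : set Y) (V0_nbhs : exists2 y0, Phi (x0, 0) = Some y0 & nbhs y0 V0)
    (X_fc : first_countable X) (Y_fc : first_countable Y)
    (X_complete : complete_space X) (Y_complete : complete_space Y) :
  let proj := fun p : X * Z => p.2 in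
  let Z0 := lin (proj @` dom Phi) in
  barreled_subspace Z0 ->
  icr (proj @` dom Phi) 0 ->
  interior ([set z : Z | exists x y, [/\ U0 x, V0 y & leK K (Phi (x, z)) y]]
            : set (subspace Z0)) (0 : subspace Z0).
Proof.
move=> proj Z0 barZ0 icr0.
have [y0 Phi0 V0y0] := V0_nbhs.
have K0 : K 0.
  have [k /interior_subset Kk] := K_int.
  by have := K_cone.2 0 k (lexx _) Kk; rewrite scale0r.
have epi_dom p y : Phi p = Some y -> epigraph K Phi (p, y).
  by move=> py; exists 0 => //=; rewrite py /= addr0.
have projD0 : (proj @` dom Phi) 0 by exists (x0, 0).
(* Besides moving the base point to the origin, [shift] regroups the coordinates so that [X * Y] is
   the source of the relation and [Z] its target. *)
pose shift (p : X * Y * Z) : X * Z * Y := ((x0 + p.1.1, p.2), y0 + p.1.2).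
pose C : set (X * Y * Z) := shift @^-1` epigraph K Phi.
have shift_continuous : continuous shift.
  have addc (T : tvsType R) (a : T) : continuous (fun x => a + x).
    by move=> x; have := @affine_continuous R T a 1 x;
      under eq_fun do rewrite scale1r.
  move=> p; apply: (@cvg_pair _ _ _ _ (nbhs (x0 + p.1.1, p.2))
    (nbhs (y0 + p.1.2))).
    apply: (@cvg_pair _ _ _ _ (nbhs (x0 + p.1.1)) (nbhs p.2)).
      apply: (@continuous_comp _ _ _ (fun p : X * Y * Z => p.1.1)
        (fun x => x0 + x)); last exact: addc.
      by apply: continuous_comp; [exact: cvg_fst|exact: cvg_fst].
    exact: cvg_snd.
  apply: (@continuous_comp _ _ _ (fun p : X * Y * Z => p.1.2)
    (fun y => y0 + y)); last exact: addc.
  by apply: continuous_comp; [exact: cvg_fst|exact: cvg_snd].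
have clC : closed C by exact: closed_comp.
have cC : convex_set (C : set (convex_lmodType (X * Y * Z)%type)).
  move/convex_setP: Phi_convex => cPhi; apply/convex_setP => t p q t01 Cp Cq.
  rewrite /C /=; have := cPhi _ _ _ t01 Cp Cq; congr (epigraph _ _ _).
  have mid (T : lmodType R) (a u v : T) :
      t *: (a + u) + (1 - t) *: (a + v) = a + (t *: u + (1 - t) *: v).
    by rewrite !scalerDr addrACA -scalerDl [t + _]addrC subrK scale1r.
  by congr (_, _, _); exact: mid.
have C0 : C ((0, 0), 0) by rewrite /C /= /shift /= !addr0; exact: epi_dom.
have CZ0 p : C p -> Z0 p.2.
  move=> [k _ /= E]; apply: sub_gen_smallest; exists (x0 + p.1.1, p.2) => //.
  by move=> N; rewrite N in E.
have absC : absorbing_in Z0 (graph_image C setT).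
  move=> z /(lin_sub_aff projD0)/icr0[d d0 dP]; exists d => // r rd.
  have [[x z'] /=] := dP r rd; rewrite add0r /dom /= => + zE; rewrite -zE.
  case E : (Phi (x, z')) => [y|//] _.
  exists (x - x0, y - y0) => //; rewrite /C /= /shift /=.
  by rewrite [x0 + _]addrC [y0 + _]addrC !subrK; exact: epi_dom.
have nW : nbhs (0 : X * Y) ([set x | U0 (x0 + x)] `*` [set y | V0 (y0 + y)]).
  have addc (T : tvsType R) (a : T) (V : set T) :
      nbhs a V -> nbhs 0 [set x | V (a + x)].
    have := @affine_continuous R T a 1 0; rewrite /continuous_at scale1r addr0.
    by move=> /[apply]; apply: (@filterS _ (nbhs 0)) => x /=; rewrite scale1r.
  by exists ([set x | U0 (x0 + x)], [set y | V0 (y0 + y)]) => //; split; exact: addc.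
have := @nbhs_graph_image R (X * Y)%type Z C Z0 _ (first_countable_prod X_fc Y_fc)
  (complete_space_prod X_complete Y_complete) clC cC C0
  (linear_subspace_lin _) barZ0 CZ0 absC nW.
apply: filterS => z [[x y] /= [Ux Vy] [k Kk /=]] E.
exists (x0 + x), (y0 + y); split => //.
(* The epigraph excludes [None] and gives [y0 + y = y1 + k], so [y1 - (y0 + y)] is [- k]. *)
move: E; case: (Phi (x0 + x, z)) => [y1 [->]|//] /=.
by exists k => //; rewrite opprD addNKr.
Qed.
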